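(* Let $\kappa=\kappa_m>0$ satisfy $\kappa/m \to \bar\kappa \geq 0$, as $m\to\infty$, where $n=n_m$ may vary with $m$. Let $L=(L_1,\ldots,L_n)$ be the stationary vector of single-server queue lengths in the homogeneous closed network with $m$ customers, $n$ single-server queues and parameter $\kappa$, and let $L_\vee=\max_i L_i$. Then, as $n\to\infty$ (along with $m\to\infty$), \[ \frac{\ln \eta}{\ln n}\, L_\vee \stackrel{\Pr}{\rightarrow} 1 \quad\text{(convergence in probability)}, \] where \begin{itemize} \item if $\bar\kappa > 1$ and $m \gg n \gg 1$, then $\eta=\bar\kappa$; \item if $n/m \to \bar n >0$, then $\eta>1$ is the root of $\eta^2 - \eta(\bar n +\bar\kappa+1) + \bar\kappa$. \end{itemize}
   Context: Model: a closed network with $m$ customers, one infinite-server node and $n$ infinite-buffer single-server queues. Service times at the infinite-server node are exponential with rate $\lambda$; after service there, a customer is routed to single-server queue $i$ with probability $p_i>0$, $\sum_{i=1}^n p_i=1$; service times at queue $i$ are exponential with rate $\mu_i$; all service times are independent; after service at a single-server queue the customer rejoins the infinite-server node. The network is homogeneous: $\kappa^{-1}=p_i\lambda/\mu_i$ for all $i$. Its stationary distribution of the single-server queue lengths is \[ \pi(l)=\Pr[L=l]=c_{m,n}^{-1}\, m!\,\frac{\kappa^{-|l|}}{(m-|l|)!},\qquad l\in\{0,1,2,\ldots\}^n,\ |l|:=l_1+\cdots+l_n\le m, \] where $c_{m,n}$ is the normalization constant, and $L=(L_1,\ldots,L_n)$ is a random vector distributed according to $\pi$. The notation $f\gg g$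 means $g/f\to 0$ in the stated limit; in particular $m\gg n\gg 1$ means $n\to\infty$ and $n/m\to0$ as $m\to\infty$. *)

(* Defs.v *)
From HB Require Import structures.
From mathcomp Require Import all_boot all_order all_algebra.
From mathcomp Require Import all_classical all_reals all_analysis.

Set Implicit Arguments.
Unset Strict Implicit.
Unset Printing Implicit Defensive.

Import Order.TTheory GRing.Theory Num.Theory.
Import numFieldNormedType.Exports.

Local Open Scope classical_set_scope.
Local Open Scope ring_scope.

(* One infinite-server node of rate [is_rate] feeding [n] single-server queues;
   the number of customers is a separate parameter. The normalization of
   [routing] forces 0 < n. *)
Record network (R : realType) (n : nat) := Network {
  is_rate : R;
  routing : 'I_n -> R;
  queue_rate : 'I_n -> R;
  is_rate_gt0 : 0 < is_rate;
  routing_gt0 : forall i, 0 < routing i;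
  routing_sum1 : \sum_i routing i = 1;
  queue_rate_gt0 : forall i, 0 < queue_rate i
}.

Definition homogeneous (R : realType) (n : nat) (N : network R n) (kappa : R) :=
  forall i, kappa^-1 = routing N i * is_rate N / queue_rate N i.

(* Vectors of single-server queue lengths when [m] customers circulate; the
   other [m - |l|] customers are at the infinite-server node. *)
Definition state (n m : nat) :=
  {l : {ffun 'I_n -> 'I_m.+1} | (\sum_i (l i : nat) <= m)%N}.

Definition qlen (n m : nat) (l : state n m) (i : 'I_n) : nat := val l i.

Definition total_qlen (n m : nat) (l : state n m) : nat := (\sum_i qlen l i)%N.

(* l' = l + e_i *)
Definition adds_one (n m : nat) (i : 'I_n) (l l' : state n m) : bool :=
  [forall j, qlen l' j == (qlen l j + (j == i))%N].

(* Transition rates of the queue-length Markov process: by memorylessness, each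
   of the m - |l| customers at the infinite-server node joins queue i at rate
   lambda * p_i, and a nonempty queue i releases a customer at rate mu_i. *)
Definition transition_rate (R : realType) (n m : nat) (N : network R n)
    (l l' : state n m) : R :=
  \sum_i (if adds_one i l l' then (m - total_qlen l)%:R * is_rate N * routing N i
          else 0)
  + \sum_i (if adds_one i l' l then queue_rate N i else 0).

(* Global balance. Here q x x plays no role: it occurs on both sides. *)
Definition stationary_distribution (R : realType) (S : finType)
    (q : S -> S -> R) (nu : S -> R) : Prop :=
  [/\ forall x, 0 <= nu x,
      \sum_x nu x = 1 &
      forall y, \sum_x nu x * q x y = nu y * \sum_z q y z].

(* The masses of the states sum to 1, so L lies in the state space a.s. *)
Definition stationary_vector (R : realType) (n m : nat) (N : network R n)
    (d : measure_display) (T : measurableType d) (P : probability T R)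
    (L : 'I_n -> {RV P >-> nat}) : Prop :=
  stationary_distribution (transition_rate (m := m) N)
    (fun l => fine (P [set w | forall i, L i w = qlen l i])).

Definition max_queue (R : realType) (n : nat) (d : measure_display)
    (T : measurableType d) (P : probability T R)
    (L : 'I_n -> {RV P >-> nat}) (w : T) : nat :=
  (\max_(i < n) L i w)%N.

(* Convergence in probability to a constant, each X_m living on its own
   probability space. *)
Definition cvg_in_probability (R : realType) (d : nat -> measure_display)
    (T : forall m, measurableType (d m)) (P : forall m, probability (T m) R)
    (X : forall m, T m -> R) (c : R) : Prop :=
  forall eps : R, 0 < eps ->
    P m [set w | eps < `|X m w - c|] @[m --> \oo] --> (0 : \bar R).

(* Main.v *)
(* Detailed balance gives the product form: any stationary law is
   proportional to a^|l| m^_|l| with a = 1 / kappa. Shifting the queue lengths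
   by a vector v turns the weights for m customers into those for m - |v|
   customers, so that P(L >= v) is the product of rho_(m - t) over t < |v|,
   where rho_j is the utilization of a queue with j customers in the network.
   The same shift yields a three-term recursion for the normalization constant,
   i.e. rho_(j+1) = (j+1) / (kappa (1 - rho_j) + n + j).

   This sequence is nondecreasing, so P(L_i >= k) <= rho_m^k, and the events
   L_i >= k are pairwise negatively correlated. The union bound and the
   second-moment method place max L around the k with n rho^k of order 1.
   After division by m, the fixed points of the recursion become the r with
   kbar r^2 - (nbar + kbar + 1) r + 1 = 0, whose smaller root is 1 / eta. *)

Require Import Defs.
From HB Require Import structures.
From mathcomp Require Import all_boot all_order all_algebra.
From mathcomp Require Import all_classical all_reals all_analysis.
From mathcomp Require Import ring lra zify.

Import Order.TTheory GRing.Theory Num.Theory.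
Import numFieldNormedType.Exports.

Local Open Scope classical_set_scope.
Local Open Scope ring_scope.

Set Implicit Arguments.
Unset Strict Implicit.
Unset Printing Implicit Defensive.

(** * Product-form weights, shifts and the normalization constant *)

Definition tot (n M : nat) (l : {ffun 'I_n -> 'I_M.+1}) : nat :=
  (\sum_i (l i : nat))%N.

(* With a = 1 / kappa, this is the j! kappa^-s / (j - s)! of the product form,
   extended by 0 to s > j. *)
Definition weight (R : realType) (a : R) (j s : nat) : R :=
  a ^+ s * (j ^_ s)%:R.

(* The constant c_(j, n), provided that j <= M: the weights vanish when
   |l| > j. One M serves all j <= M, so changing the number of customers does
   not change the index type. *)
Definition partition_fun (R : realType) (a : R) (n M j : nat) : R :=
  \sum_(l : {ffun 'I_n -> 'I_M.+1}) weight a j (tot l).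

(* inord is 0 out of range: this is l + v only if every l_i + v_i <= M. *)
Definition shift (n M : nat) (v : 'I_n -> nat) (l : {ffun 'I_n -> 'I_M.+1}) :
  {ffun 'I_n -> 'I_M.+1} := [ffun i => inord (l i + v i)].

Lemma leq_tot (n M : nat) (l : {ffun 'I_n -> 'I_M.+1}) i : (l i <= tot l)%N.
Proof. by rewrite /tot (bigD1 i)//= leq_addr. Qed.

Lemma shiftE (n M : nat) (v : 'I_n -> nat) (l : {ffun 'I_n -> 'I_M.+1}) :
  (tot l + \sum_i v i <= M)%N ->
  forall i, shift v l i = (l i + v i)%N :> nat.
Proof.
move=> h i; rewrite ffunE inordK// ltnS (leq_trans _ h)// leq_add ?leq_tot//.
by rewrite (bigD1 i)//= leq_addr.
Qed.

Lemma tot_shift (n M : nat) (v : 'I_n -> nat) (l : {ffun 'I_n -> 'I_M.+1}) :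
  (tot l + \sum_i v i <= M)%N ->
  tot (shift v l) = (tot l + \sum_i v i)%N.
Proof.
by move=> h; rewrite /tot -big_split/=; apply: eq_bigr => i _; rewrite shiftE.
Qed.

(** Translation by v is injective, with inverse l - v; the bounds on the totals keep every
    coordinate within M, so [inord] never falls back to 0. *)
Lemma sum_shift (R : realType) (n M : nat) (v : 'I_n -> nat)
    (G : {ffun 'I_n -> 'I_M.+1} -> R) :
  \sum_(l : {ffun 'I_n -> 'I_M.+1} | [forall i, v i <= l i]%N && (tot l <= M)%N)
    G l =
  \sum_(l : {ffun 'I_n -> 'I_M.+1} | (tot l + \sum_i v i <= M)%N)
    G (shift v l).
Proof.
rewrite (reindex_onto (shift v)
  (fun l : {ffun 'I_n -> 'I_M.+1} => [ffun i => inord (l i - v i)])) /=.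
  apply: eq_bigl => l; apply/idP/idP; last first.
    move=> h; rewrite tot_shift// h andbT; apply/andP; split.
      by apply/forallP => i; rewrite shiftE// leq_addl.
    apply/eqP/ffunP => i; apply: ord_inj; rewrite ffunE shiftE// addnK.
    by rewrite inordK.
  move=> /andP[/andP[/forallP h1 h2] /eqP h3].
  suff -> : (tot l + \sum_i v i)%N = tot (shift v l) by [].
  rewrite {1}/tot -big_split/=; apply: eq_bigr => i _.
  rewrite -[in LHS]h3 [X in (nat_of_ord X + _)%N]ffunE inordK ?subnK//.
  by rewrite ltnS (leq_trans (leq_subr _ _))// -ltnS.
move=> l /andP[/forallP h1 h2]; apply/ffunP => i; apply: ord_inj.
have hK : (inord (l i - v i) : 'I_M.+1) = (l i - v i)%N :> nat.
  by rewrite inordK// ltnS (leq_trans (leq_subr _ _))// -ltnS.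
by rewrite !ffunE hK subnK// inord_val.
Qed.

Lemma weight_eq0 (R : realType) (a : R) (j s : nat) :
  (j < s)%N -> weight a j s = 0.
Proof. by move=> h; rewrite /weight ffact_small// mulr0. Qed.

Lemma weight_ge0 (R : realType) (a : R) (j s : nat) :
  0 <= a -> 0 <= weight a j s.
Proof. by move=> h; rewrite /weight mulr_ge0// exprn_ge0. Qed.

Lemma ffactnD (n p q : nat) : (n ^_ (p + q) = n ^_ p * (n - p) ^_ q)%N.
Proof.
elim: p n => [|p IH] n; first by rewrite ffactn0 mul1n subn0.
case: n => [|n]; first by rewrite addSn !ffact0n.
by rewrite addSn !ffactSS IH subSS mulnA.
Qed.

Lemma weightD (R : realType) (a : R) (j s t : nat) :
  weight a j (t + s) = weight a j s * weight a (j - s) t.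
Proof. rewrite /weight addnC ffactnD natrM exprD; ring. Qed.

(** By [weightD], the weight of a shifted vector is a constant times a weight with |v| fewer
    customers. Totals beyond M drop out, since j <= M makes their weights vanish. *)
Lemma sum_weight_tail (R : realType) (a : R) (n M j : nat) (v : 'I_n -> nat) :
  (j <= M)%N ->
  \sum_(l : {ffun 'I_n -> 'I_M.+1} | [forall i, v i <= l i]%N)
    weight a j (tot l) =
  weight a j (\sum_i v i) * partition_fun a n M (j - \sum_i v i).
Proof.
move=> jM; set s := (\sum_i v i)%N.
rewrite (bigID (fun l : {ffun 'I_n -> 'I_M.+1} => tot l <= M)%N)/=.
rewrite [X in _ + X]big1 ?addr0 => [|l /andP[_]]; last first.
  by rewrite -ltnNge => h; rewrite weight_eq0// (leq_ltn_trans jM).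
rewrite (sum_shift v (fun l : {ffun 'I_n -> 'I_M.+1} => weight a j (tot l))).
under [LHS]eq_bigr => l h do rewrite tot_shift// weightD.
rewrite -mulr_sumr -/s; have [js|sj] := ltnP j s.
  by rewrite (weight_eq0 _ js) !mul0r.
congr (_ * _); rewrite /partition_fun [RHS](bigID
  (fun l : {ffun 'I_n -> 'I_M.+1} => tot l + s <= M)%N)/=.
rewrite [X in _ = _ + X]big1 ?addr0// => l; rewrite -ltnNge => h.
by rewrite weight_eq0//; lia.
Qed.

(** Shift by the unit vector at [i0]. The hypotheses on F discard what the shift misses: vectors
    with l_i0 = 0 and totals that are too large. *)
Lemma sum_shift1 (R : realType) (n M : nat) (i0 : 'I_n)
    (F : nat -> nat -> R) :
  (forall p s, (M < s)%N -> F p s = 0) ->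
  (forall s, F 0%N s = 0) ->
  \sum_(l : {ffun 'I_n -> 'I_M.+1}) F (l i0) (tot l) =
  \sum_(l : {ffun 'I_n -> 'I_M.+1}) F (l i0).+1 (tot l).+1.
Proof.
move=> F0 Fz.
pose v (i : 'I_n) : nat := i == i0.
have v1 : (\sum_i v i = 1)%N.
  by rewrite /v (bigD1 i0)//= eqxx big1// => i /negbTE ->.
have := sum_shift v (fun l : {ffun 'I_n -> 'I_M.+1} => F (l i0) (tot l)).
under [X in _ = X -> _]eq_bigr => l h.
  rewrite tot_shift// shiftE// v1 /v eqxx !addn1; over.
rewrite v1 => E.
rewrite (bigID (fun l : {ffun 'I_n -> 'I_M.+1} =>
  [forall i, v i <= l i]%N && (tot l <= M)%N))/= E.
rewrite [X in _ + X]big1 ?addr0 => [|l]; last first.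
  rewrite negb_and => /orP[/forallPn[i]|]; last by rewrite -ltnNge => /F0.
  rewrite -ltnNge /v; case: eqP => // -> /=.
  by rewrite ltnS leqn0 => /eqP ->; rewrite Fz.
rewrite [RHS](bigID (fun l : {ffun 'I_n -> 'I_M.+1} => tot l + 1 <= M)%N)/=.
rewrite [X in _ = _ + X]big1 ?addr0// => l; rewrite -ltnNge => h.
by rewrite F0//; lia.
Qed.

Lemma ffactS_sub (j s : nat) : (j.+1 ^_ s = j ^_ s + s * j ^_ s.-1)%N.
Proof.
case: s => [|s]; first by rewrite !ffactn0.
rewrite ffactSS ffactnSr /=; have [sj|js] := leqP s j; last first.
  by rewrite ffact_small// !muln0.
by rewrite [(_ * (j - s))%N]mulnC -mulnDl; congr (_ * _)%N; lia.
Qed.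

(** Passing from j to j + 1 changes the weight by a^s s j^_(s-1), where s = |l|. Writing s as the
    sum of the l_i and removing a customer from queue i in the i-th term leaves weights with j
    customers times a (1 + l_i). Summing over i gives n + |l|, and |l| is eliminated through j
    (j-1)^_s = (j - s) j^_s. *)
Lemma partition_fun_rec (R : realType) (a : R) (n M j : nat) : (j < M)%N ->
  partition_fun a n M j.+1 =
  partition_fun a n M j * (1 + a * (n + j)%:R)
  - a * j%:R * partition_fun a n M j.-1.
Proof.
move=> jM.
(* At s = 0 the truncated [s.-1] is harmless: every l_i is then 0, and so is the factor p. *)
pose F (p s : nat) : R := p%:R * (a ^+ s * (j ^_ s.-1)%:R).
have F0 p s : (M < s)%N -> F p s = 0.
  by move=> h; rewrite /F ffact_small ?mulr0//; lia.
have E1 : partition_fun a n M j.+1 - partition_fun a n M j =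
    \sum_i \sum_(l : {ffun 'I_n -> 'I_M.+1}) F (l i) (tot l).
  rewrite exchange_big/= /partition_fun -sumrB; apply: eq_bigr => l _.
  rewrite /weight ffactS_sub natrD natrM mulrDr addrAC subrr add0r.
  by rewrite /F -mulr_suml -natr_sum -/(tot l) mulrCA.
have E2 i : \sum_(l : {ffun 'I_n -> 'I_M.+1}) F (l i) (tot l) =
    \sum_(l : {ffun 'I_n -> 'I_M.+1}) a * (1 + (l i)%:R) * weight a j (tot l).
  rewrite sum_shift1//; last by move=> s; rewrite /F mul0r.
  apply: eq_bigr => l _.
  by rewrite /F /weight exprS -natr1/=; ring.
have E3 : \sum_(l : {ffun 'I_n -> 'I_M.+1}) (tot l)%:R * weight a j (tot l) =
    j%:R * (partition_fun a n M j - partition_fun a n M j.-1).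
  rewrite /partition_fun -sumrB mulr_sumr; apply: eq_bigr => l _.
  have [lj|jl] := leqP (tot l) j; last by rewrite !weight_eq0 ?subrr ?mulr0//; lia.
  rewrite /weight.
  have /(congr1 (fun k : nat => k%:R : R)) :
      (j * j.-1 ^_ (tot l) = j ^_ (tot l) * (j - tot l))%N.
    by rewrite -ffactnS ffactnSr.
  rewrite !natrM natrB// => h.
  rewrite mulrBr [X in _ = _ - X]mulrCA h; ring.
apply/eqP; rewrite -subr_eq0; apply/eqP.
rewrite -[partition_fun a n M j.+1](subrK (partition_fun a n M j)) E1.
under eq_bigr => i _ do rewrite E2.
rewrite exchange_big/=.
have -> : \sum_(l : {ffun 'I_n -> 'I_M.+1})
     \sum_i a * (1 + (l i)%:R) * weight a j (tot l) =
   a * (n%:R * partition_fun a n M j +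
     \sum_(l : {ffun 'I_n -> 'I_M.+1}) (tot l)%:R * weight a j (tot l)).
  rewrite /partition_fun !mulr_sumr -big_split/= mulr_sumr; apply: eq_bigr => l _.
  rewrite -mulr_suml -mulr_sumr big_split/= sumr_const card_ord.
  rewrite -natr_sum -/(tot l); ring.
rewrite E3 natrD; ring.
Qed.

Lemma partition_fun_gt0 (R : realType) (a : R) (n M j : nat) :
  0 <= a -> 0 < partition_fun a n M j.
Proof.
move=> a0; rewrite /partition_fun (bigD1 [ffun=> ord0])//=.
rewrite (_ : tot _ = 0%N); last first.
  by rewrite /tot big1// => i _; rewrite ffunE.
rewrite ltr_pwDl//; first by rewrite /weight mul1r ffactn0.
by apply: sumr_ge0 => l _; apply: weight_ge0.
Qed.

(** * The utilization recursion: monotonicity, product formula and bounds *)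

Fixpoint rho (R : realType) (kappa : R) (n j : nat) : R :=
  if j is j'.+1 then j%:R / (kappa * (1 - rho kappa n j') + (n + j')%:R) else 0.

Lemma rhoS (R : realType) (kappa : R) (n j : nat) :
  rho kappa n j.+1 = j.+1%:R / (kappa * (1 - rho kappa n j) + (n + j)%:R).
Proof. by []. Qed.

(** Since n >= 1, a utilization of at most 1 at j makes the next denominator at least n + j >= j +
    1. *)
Lemma rho_itv (R : realType) (kappa : R) (n j : nat) :
  0 < kappa -> (0 < n)%N -> 0 <= rho kappa n j <= 1.
Proof.
move=> k0 n0; elim: j => [|j /andP[IH0 IH1]]; first by rewrite lexx ler01.
rewrite rhoS; set D := _ + _.
have hD : j.+1%:R <= D.
  rewrite /D -[leLHS]add0r lerD ?mulr_ge0 ?subr_ge0 ?(ltW k0)// ler_nat.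
  by rewrite -add1n leq_add2r.
have D0 : 0 < D by rewrite (lt_le_trans _ hD)// ltr0n.
by rewrite divr_ge0 ?(ltW D0)//= ler_pdivrMr// mul1r.
Qed.

Lemma rho_den_gt0 (R : realType) (kappa : R) (n j : nat) :
  0 < kappa -> (0 < n)%N -> 0 < kappa * (1 - rho kappa n j) + (n + j)%:R.
Proof.
move=> k0 n0; have /andP[_ h1] := rho_itv j k0 n0.
by rewrite ltr_wpDl ?mulr_ge0 ?subr_ge0 ?(ltW k0)// ltr0n addn_gt0 n0.
Qed.

(** With D_j the denominator of rho_(j+1), the inductive step is (j + 1) D_(j+1) <= (j + 2) D_j. The
    difference is kappa (1 - rho_j) + (n - 1) + (j + 1) kappa (rho_(j+1) - rho_j). *)
Lemma rho_homo (R : realType) (kappa : R) (n : nat) :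
  0 < kappa -> (0 < n)%N -> {homo rho kappa n : i j / (i <= j)%N >-> i <= j}.
Proof.
move=> k0 n0; apply: homo_leq => //; first exact: le_trans.
elim=> [|j IH]; first by have /andP[] := rho_itv 1 k0 n0.
have D0 := rho_den_gt0 j k0 n0; have D1 := rho_den_gt0 j.+1 k0 n0.
rewrite rhoS [leRHS]rhoS ler_pdivrMr// mulrAC ler_pdivlMr//.
move: D0 D1 IH; have /andP[_ h1] := rho_itv j k0 n0.
have /andP[_ h2] := rho_itv j.+1 k0 n0.
move: h1 h2; set x := rho _ _ j; set y := rho _ _ j.+1.
clearbody x y => x1 y1 D0 D1 xy.
have n1 : 1 <= n%:R :> R by rewrite ler1n.
have j0 : 0 <= j%:R :> R by [].
rewrite !natrD -!natr1 in D0 D1 *.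
have A0 : 0 <= kappa * (1 - x) by rewrite mulr_ge0 ?subr_ge0 ?(ltW k0).
have A1 : kappa * (1 - y) <= kappa * (1 - x) by rewrite ler_pM2l// lerB.
have : 0 <= (j%:R + 1) * (kappa * (1 - x) - kappa * (1 - y)).
  by rewrite mulr_ge0 ?subr_ge0// addr_ge0.
lra.
Qed.

(** Identifies rho_j with j Z_(j-1) / (kappa Z_j), Z being the normalization constant: inserted into
    the three-term recursion, this gives Z_(j+1) = Z_j D_j / kappa, where D_j is the denominator of
    rho_(j+1). *)
Lemma rho_partition_fun (R : realType) (kappa : R) (n M j : nat) :
  0 < kappa -> (0 < n)%N -> (j <= M)%N ->
  kappa^-1 * j%:R * partition_fun kappa^-1 n M j.-1 =
  rho kappa n j * partition_fun kappa^-1 n M j.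
Proof.
move=> k0 n0; elim: j => [|j IH] jM; first by rewrite mulr0 !mul0r.
have := IH (ltnW jM) => {}IH.
rewrite (partition_fun_rec _ n jM) IH rhoS/=.
have D0 := rho_den_gt0 j k0 n0.
field.
by rewrite (gt_eqF k0)/= -natrD (gt_eqF D0).
Qed.

(** The ratios of [rho_partition_fun] telescope, one factor per removed customer. *)
Lemma weight_partition_fun (R : realType) (kappa : R) (n M j s : nat) :
  0 < kappa -> (0 < n)%N -> (j <= M)%N ->
  weight kappa^-1 j s * partition_fun kappa^-1 n M (j - s) =
  (\prod_(t < s) rho kappa n (j - t)) * partition_fun kappa^-1 n M j.
Proof.
move=> k0 n0 jM; elim: s => [|s IH].
  by rewrite subn0 big_ord0 /weight expr0 ffactn0 mul1r.
rewrite big_ord_recr/= [RHS]mulrAC -IH -[RHS]mulrA [_ * rho _ _ _]mulrC.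
rewrite -(rho_partition_fun k0 n0 (leq_trans (leq_subr s j) jM)).
by rewrite subnS -[s.+1]add1n weightD -[LHS]mulrA [weight _ _ 1]/weight ffactn1.
Qed.

(* rho_(m - 1) <= rho_m in the recursion shows that rho_m is a point of
   nonnegativity of a convex quadratic, which is negative at r and at 1. *)
Lemma rho_lt (R : realType) (kappa : R) (n m : nat) (r : R) :
  0 < kappa -> (1 < n)%N -> (0 < m)%N -> r < 1 ->
  kappa * r ^+ 2 - (kappa + n%:R + m%:R) * r + r + m%:R < 0 ->
  rho kappa n m < r.
Proof.
case: m => // m k0 n1 _ r1 hr; rewrite ltNge; apply/negP => rx.
have n0 := ltnW n1.
have D0 := rho_den_gt0 m k0 n0.
have /andP[x0 x1] := rho_itv m.+1 k0 n0.
have : rho kappa n m.+1 * (kappa * (1 - rho kappa n m) + (n + m)%:R) = m.+1%:R.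
  by rewrite rhoS divfK// gt_eqF.
have := rho_homo k0 n0 (leqnSn m).
move: x0 x1 rx; set x := rho _ _ m.+1; set y := rho _ _ m.
clearbody x y.
rewrite natrD -natr1 in hr *.
have n1' : 2 <= n%:R :> R by rewrite ler_nat.
move=> x0 x1 rx yx E.
have E2 : 0 <= kappa * x ^+ 2 - (kappa + n%:R + m%:R) * x + (m%:R + 1).
  rewrite -E; have : 0 <= kappa * x * (x - y).
    by rewrite !mulr_ge0 ?subr_ge0 ?(ltW k0).
  lra.
(* The chord identity on [r, 1] for the quadratic Q of [E2], where Q(1) = 1 - n; the last term is
   the convexity gap. *)
have : (1 - r) * (kappa * x ^+ 2 - (kappa + n%:R + m%:R) * x + (m%:R + 1)) =
  (1 - x) * (kappa * r ^+ 2 - (kappa + n%:R + (m%:R + 1)) * r + r + (m%:R + 1)) +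
  (x - r) * (1 - n%:R) - kappa * (1 - r) * (x - r) * (1 - x) by ring.
have T1 : 0 <= (1 - r) * (kappa * x ^+ 2 - (kappa + n%:R + m%:R) * x + (m%:R + 1)).
  by rewrite mulr_ge0// subr_ge0 ltW.
have T2 : 0 <= kappa * (1 - r) * (x - r) * (1 - x).
  by rewrite !mulr_ge0 ?subr_ge0 ?(ltW k0)// ltW.
have T3 : 0 <= (x - r) * (n%:R - 1) by rewrite mulr_ge0 ?subr_ge0//; lra.
have T4 : 0 <= (1 - x) * - (kappa * r ^+ 2 - (kappa + n%:R + (m%:R + 1)) * r + r + (m%:R + 1)).
  by rewrite mulr_ge0 ?subr_ge0// oppr_ge0 ltW.
move=> E3.
have [xr|xr] := eqVneq x r.
  by move: E2 hr; rewrite xr; lra.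
have T5 : 0 < (x - r) * (n%:R - 1).
  by rewrite mulr_gt0 ?subr_gt0 ?lt_neqAle 1?eq_sym ?xr//; lra.
lra.
Qed.

(* As long as rho stays below r, each step of the recursion adds at least c,
   and S steps of size c would leave [0, 1]. *)
Lemma le_rho (R : realType) (kappa : R) (n j0 J S : nat) (c r : R) :
  0 < kappa -> (0 < n)%N -> 0 <= r <= 1 -> 0 <= c -> (j0 + S <= J)%N ->
  2 * kappa * r <= kappa + n%:R + j0%:R ->
  c * (kappa + n%:R + J%:R) <=
    kappa * r ^+ 2 - (kappa + n%:R + j0%:R) * r + j0%:R ->
  1 < c * S%:R -> r <= rho kappa n J.
Proof.
move=> k0 n0 /andP[r0 r1] c0 jS h2 hc cS; rewrite leNgt; apply/negP => Jr.
suff H t : (t <= S)%N -> c * t%:R <= rho kappa n (j0 + t).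
  have := H S (leqnn S); have /andP[_] := rho_itv (j0 + S) k0 n0; lra.
elim: t => [|t IH] tS; first by rewrite mulr0; have /andP[] := rho_itv (j0 + 0) k0 n0.
have {}IH := IH (ltnW tS).
have tJ : (j0 + t < J)%N by rewrite (leq_trans _ jS)// -addnS leq_add2l.
rewrite addnS; set j := (j0 + t)%N in IH tJ *.
have D0 := rho_den_gt0 j k0 n0.
have /andP[x0 x1] := rho_itv j k0 n0.
have xr : rho kappa n j <= r.
  by rewrite (le_trans _ (ltW Jr))// rho_homo// ltnW.
rewrite rhoS; move: D0 x0 x1 xr IH; set x := rho _ _ j.
clearbody x => D0 x0 x1 xr IH.
rewrite -!natr1 natrD in D0 *.
have jJ : j%:R + 1 <= J%:R :> R by rewrite natr1 ler_nat.
have j0j : j0%:R <= j%:R :> R by rewrite ler_nat leq_addr.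
rewrite ler_pdivlMr//.
suff : c * (kappa * (1 - x) + (n%:R + j%:R)) <=
    kappa * x ^+ 2 - (kappa + n%:R + j%:R) * x + j%:R.
  have : c * t%:R * (kappa * (1 - x) + (n%:R + j%:R)) <=
     x * (kappa * (1 - x) + (n%:R + j%:R)) by rewrite ler_pM2r.
  lra.
apply: (@le_trans _ _ (c * (kappa + n%:R + J%:R))).
  have : 0 <= c * (kappa * x + (J%:R - j%:R)).
    by rewrite !mulr_ge0// addr_ge0 ?mulr_ge0 ?(ltW k0)//; lra.
  lra.
apply: (le_trans hc).
(* By [h2] the vertex of the quadratic is not to the left of r, so its value at x <= r is at least
   that at r. [T2] pays for replacing [j0] by [j]. *)
have T1 : 0 <= (r - x) * (kappa + n%:R + j0%:R - kappa * (r + x)).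
  rewrite mulr_ge0 ?subr_ge0// (le_trans _ h2)//.
  have : 0 <= kappa * (r - x) by rewrite mulr_ge0 ?subr_ge0 ?(ltW k0).
  lra.
have T2 : 0 <= (1 - x) * (j%:R - j0%:R) by rewrite mulr_ge0 ?subr_ge0.
lra.
Qed.

(** * Detailed balance and uniqueness of the stationary law *)

Lemma total_qlen_adds_one (n m : nat) (i : 'I_n) (x y : state n m) :
  adds_one i x y -> total_qlen y = (total_qlen x).+1.
Proof.
move=> /forallP h; rewrite /total_qlen.
under eq_bigr => j _ do rewrite (eqP (h j)).
rewrite big_split/= -addn1; congr (_ + _)%N.
by rewrite (bigD1 i)//= eqxx big1// => j /negbTE ->.
Qed.

Lemma transition_rate_ge0 (R : realType) (n m : nat) (N : network R n)
    (x y : state n m) : 0 <= transition_rate N x y.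
Proof.
have l0 := is_rate_gt0 N.
rewrite addr_ge0// sumr_ge0// => i _; case: ifP => // _.
  by rewrite !mulr_ge0 ?(ltW l0) ?(ltW (routing_gt0 N i)).
exact: ltW (queue_rate_gt0 N i).
Qed.

(** Arrivals from x to y balance departures from y to x, hence the swap of the two sums. One more
    customer at queue i multiplies the weight by (m - |x|) / kappa, which by homogeneity is the
    arrival rate over the service rate. *)
Lemma detailed_balance (R : realType) (n m : nat) (N : network R n)
    (kappa : R) (x y : state n m) : homogeneous N kappa ->
  weight kappa^-1 m (total_qlen x) * transition_rate N x y =
  weight kappa^-1 m (total_qlen y) * transition_rate N y x.
Proof.
move=> hN; rewrite /transition_rate !mulrDr addrC; congr (_ + _); last first.
  rewrite !mulr_sumr; apply: eq_bigr => i _.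
  case: ifP => [/total_qlen_adds_one h|]; last by rewrite !mulr0.
  rewrite h /weight exprS ffactnSr natrM (hN i).
  by field; rewrite gt_eqF// queue_rate_gt0.
rewrite !mulr_sumr; apply: eq_bigr => i _.
case: ifP => [/total_qlen_adds_one h|]; last by rewrite !mulr0.
rewrite h /weight exprS ffactnSr natrM (hN i).
by field; rewrite gt_eqF// queue_rate_gt0.
Qed.

Lemma exists_remove_one (n m : nat) (y : state n m) :
  (0 < total_qlen y)%N -> exists i, exists x : state n m, adds_one i x y.
Proof.
move=> y0; have [i yi] : exists i, (0 < qlen y i)%N.
  apply/existsP; apply: contraLR y0; rewrite negb_exists => /forallP h.
  by rewrite -leqNgt leqn0 sum_nat_eq0; apply/forallP => i; rewrite -leqn0 leqNgt; apply: h.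
pose f := [ffun j => inord (qlen y j - (j == i)) : 'I_m.+1].
have fE j : f j = (qlen y j - (j == i))%N :> nat.
  rewrite ffunE inordK// ltnS (leq_trans (leq_subr _ _))// -ltnS.
  exact: ltn_ord.
have fm : (\sum_j (f j : nat) <= m)%N.
  apply: leq_trans (valP y); apply: leq_sum => j _.
  by rewrite fE leq_subr.
exists i, (exist _ f fm); apply/forallP => j.
rewrite /qlen/= -/(qlen y j) fE; case: (eqVneq j i) => [->|_].
  by rewrite subnK.
by rewrite subn0 addn0.
Qed.

Lemma total_qlen0_eq (n m : nat) (x y : state n m) :
  total_qlen x = 0%N -> total_qlen y = 0%N -> x = y.
Proof.
move=> /eqP + /eqP; rewrite !sum_nat_eq0 => /forallP hx /forallP hy.
apply/val_inj/ffunP => i; apply: ord_inj.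
exact: etrans (eqP (hx i)) (esym (eqP (hy i))).
Qed.

(* A maximum of h spreads to every state reached by removing a customer. *)
Lemma harmonic_max_empty (R : realType) (n m : nat) (N : network R n)
    (h : state n m -> R) (z y : state n m) :
  (forall y, \sum_x transition_rate N y x * (h x - h y) = 0) ->
  total_qlen z = 0%N -> (forall x, h x <= h y) -> h y = h z.
Proof.
move=> hh z0; elim: {y}(total_qlen y) {-2}y (erefl (total_qlen y)) => [|k IH] y yk hy.
  by rewrite (total_qlen0_eq yk z0).
have [|i [x xy]] := @exists_remove_one _ _ y; first by rewrite yk.
suff hxy : h x = h y.
  rewrite -hxy; apply: IH => [|x']; last by rewrite hxy.
  by have := total_qlen_adds_one xy; rewrite yk => -[].
have q0 : 0 < transition_rate N y x.
  rewrite ltr_wpDl//.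
    rewrite sumr_ge0// => j _; case: ifP => // _.
    by rewrite !mulr_ge0 ?(ltW (is_rate_gt0 N)) ?(ltW (routing_gt0 N j)).
  rewrite (bigD1 i)//= xy ltr_pwDl ?queue_rate_gt0//.
  by rewrite sumr_ge0// => j _; case: ifP => // _; rewrite ltW// queue_rate_gt0.
(* At a maximum all terms are nonpositive; summing to 0, each of them vanishes. *)
have /eqP := hh y; rewrite -oppr_eq0 -sumrN psumr_eq0; last first.
  move=> x' _; rewrite -mulrN opprB mulr_ge0 ?subr_ge0//.
  exact: transition_rate_ge0.
move=> /allP/(_ x); rewrite mem_index_enum => /(_ isT)/=.
by rewrite oppr_eq0 mulf_eq0 (gt_eqF q0)/= subr_eq0 => /eqP.
Qed.

(** Maximum principle: a harmonic function is maximal at the empty state. Applied to h and to -h,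
    this makes h constant. *)
Lemma harmonic_constant (R : realType) (n m : nat) (N : network R n)
    (h : state n m -> R) :
  (forall y, \sum_x transition_rate N y x * (h x - h y) = 0) ->
  forall x y, h x = h y.
Proof.
move=> hh.
have fm : (\sum_j (([ffun=> ord0] : {ffun 'I_n -> 'I_m.+1}) j : nat) <= m)%N.
  by rewrite big1// => j _; rewrite ffunE.
pose z : state n m := exist _ [ffun=> ord0] fm.
have z0 : total_qlen z = 0%N.
  by rewrite /total_qlen big1// => j _; rewrite /qlen/= ffunE.
suff H (g : state n m -> R) :
    (forall y, \sum_x transition_rate N y x * (g x - g y) = 0) ->
    forall x, g x <= g z.
  have hz x : h x = h z.
    apply/eqP; rewrite eq_le H//= -lerN2.
    apply: (H (fun x => - h x)) => y.
    have /(congr1 -%R) := hh y; rewrite oppr0 -sumrN => E.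
    apply: etrans E.
    by apply: eq_bigr => i _; ring.
  by move=> x y; rewrite (hz x) (hz y).
move=> hg x.
case: (@arg_maxP _ _ _ z xpredT g isT) => y _ hy.
have {}hy x' : g x' <= g y by exact: hy.
by rewrite -(harmonic_max_empty hg z0 hy) hy.
Qed.

Lemma sum_state (R : realType) (n m : nat) (F : {ffun 'I_n -> 'I_m.+1} -> R) :
  (forall l, (m < tot l)%N -> F l = 0) ->
  \sum_(l : state n m) F (val l) = \sum_(l : {ffun 'I_n -> 'I_m.+1}) F l.
Proof.
move=> F0; rewrite [RHS](bigID (fun l => tot l <= m)%N)/=.
rewrite [X in _ = _ + X]big1 ?addr0 => [|l]; last by rewrite -ltnNge => /F0.
rewrite (reindex_omap (val : state n m -> _) insub)/=.
  apply: eq_bigl => l; rewrite valK eqxx andbT; symmetry; exact: (valP l).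
by move=> l hl; rewrite insubT.
Qed.

Lemma stationary_product_form (R : realType) (n m : nat) (N : network R n)
    (kappa : R) (nu : state n m -> R) :
  0 < kappa -> homogeneous N kappa ->
  stationary_distribution (transition_rate N) nu ->
  forall l, nu l =
    weight kappa^-1 m (total_qlen l) / partition_fun kappa^-1 n m m.
Proof.
move=> k0 hN [nu0 nu1 hnu].
pose w (l : state n m) := weight kappa^-1 m (total_qlen l).
have w0 l : 0 < w l.
  rewrite mulr_gt0 ?exprn_gt0 ?invr_gt0// ltr0n ffact_gt0; exact: (valP l).
(* Under detailed balance, global balance says that nu / w is harmonic. *)
pose h l := nu l / w l.
have nuE l : nu l = h l * w l by rewrite /h divfK// gt_eqF.
have hc : forall x y, h x = h y.
  apply: (@harmonic_constant _ _ _ N) => y.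
  have /eqP := hnu y; rewrite mulr_sumr -subr_eq0 -sumrB => /eqP hy.
  have : w y * \sum_x transition_rate N y x * (h x - h y) = 0.
    rewrite mulr_sumr; apply: etrans hy; apply: eq_bigr => x _.
    rewrite !nuE -[h x * w x * _]mulrA (detailed_balance x y hN) -/(w y); ring.
  by move/eqP; rewrite mulf_eq0 (gt_eqF (w0 y)) => /eqP.
have Zw : \sum_l w l = partition_fun kappa^-1 n m m.
  rewrite /partition_fun -sum_state// => l; exact: weight_eq0.
move=> l; have Z0 : 0 < partition_fun kappa^-1 n m m.
  by rewrite partition_fun_gt0// invr_ge0 ltW.
have : \sum_x h l * w x = 1.
  by apply: etrans nu1; apply: eq_bigr => x _; rewrite nuE (hc x l).
rewrite -mulr_sumr Zw => hZ.
by rewrite nuE -[h l](mulfK (lt0r_neq0 Z0)) hZ mul1r mulrC.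
Qed.

(** * Joint tails of the queue lengths and bounds on their maximum *)

Lemma sum_single (n k : nat) (i : 'I_n) : (\sum_j k * (j == i) = k)%N.
Proof.
rewrite -big_distrr/= (bigD1 i)//= eqxx big1 => [|j /negbTE ->//].
by rewrite addn0 muln1.
Qed.

Lemma stationary_tail (R : realType) (n m : nat) (N : network R n) (kappa : R)
    (nu : state n m -> R) (v : 'I_n -> nat) :
  0 < kappa -> (0 < n)%N -> homogeneous N kappa ->
  stationary_distribution (transition_rate N) nu ->
  \sum_(l : state n m | [forall i, v i <= qlen l i]%N) nu l =
  \prod_(t < \sum_i v i) rho kappa n (m - t).
Proof.
move=> k0 n0 hN hnu.
have Z0 : 0 < partition_fun kappa^-1 n m m.
  by rewrite partition_fun_gt0// invr_ge0 ltW.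
have := @weight_partition_fun R kappa n m m (\sum_i v i)%N k0 n0 (leqnn m).
rewrite -sum_weight_tail// => /(congr1 (fun x => x / partition_fun kappa^-1 n m m)).
rewrite (mulfK (lt0r_neq0 Z0)) => <-.
rewrite mulr_suml big_mkcond [RHS]big_mkcond/= -sum_state; last first.
  by move=> l ml; case: ifP => // _; rewrite weight_eq0// mul0r.
by apply: eq_bigr => l _; case: ifP => // _; rewrite (stationary_product_form k0 hN hnu).
Qed.

Lemma stationary_tail1 (R : realType) (n m : nat) (N : network R n) (kappa : R)
    (nu : state n m -> R) (k : nat) (i : 'I_n) :
  0 < kappa -> (0 < n)%N -> homogeneous N kappa ->
  stationary_distribution (transition_rate N) nu ->
  \sum_(l : state n m | (k <= qlen l i)%N) nu l =
  \prod_(t < k) rho kappa n (m - t).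
Proof.
move=> k0 n0 hN hnu.
have := @stationary_tail R n m N kappa nu (fun j => k * (j == i))%N k0 n0 hN hnu.
rewrite sum_single => <-; apply: eq_bigl => l.
apply/idP/forallP => [h j|/(_ i)]; last by rewrite eqxx muln1.
by case: (eqVneq j i) => [->|_]; rewrite ?muln1 ?muln0.
Qed.

(** The joint tail is a product of 2k utilizations. Its last k factors have smaller indices than the
    first k, so monotonicity of [rho] yields the negative correlation. *)
Lemma stationary_tail2 (R : realType) (n m : nat) (N : network R n) (kappa : R)
    (nu : state n m -> R) (k : nat) (i j : 'I_n) :
  0 < kappa -> (0 < n)%N -> homogeneous N kappa -> i != j ->
  stationary_distribution (transition_rate N) nu ->
  \sum_(l : state n m | (k <= qlen l i)%N && (k <= qlen l j)%N) nu l <=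
  (\prod_(t < k) rho kappa n (m - t)) ^+ 2.
Proof.
move=> k0 n0 hN ij hnu.
have := @stationary_tail R n m N kappa nu
  (fun a => k * (a == i) + k * (a == j))%N k0 n0 hN hnu.
rewrite big_split/= !sum_single => h.
apply: (@le_trans _ _ (\prod_(t < k + k) rho kappa n (m - t))).
  rewrite -h le_eqVlt; apply/orP; left; apply/eqP; apply: eq_bigl => l.
  apply/idP/forallP => [/andP[hi hj] a|hh].
    case: (eqVneq a i) => [->|_]; first by rewrite (negbTE ij) muln1 muln0 addn0.
    by case: (eqVneq a j) => [->|_]; rewrite ?muln1 ?muln0.
  have := hh i; have := hh j; rewrite !eqxx (negbTE ij) eq_sym (negbTE ij).
  by rewrite !muln1 !muln0 addn0 add0n => -> ->.
have rho0 t : 0 <= rho kappa n t by have /andP[] := rho_itv t k0 n0.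
rewrite big_split_ord/= expr2 ler_pM ?prodr_ge0//.
apply: ler_prod => t _; have /andP[-> _]/= := rho_itv (m - (k + t)) k0 n0.
by rewrite rho_homo// leq_sub2l// leq_addl.
Qed.

(** Union bound over the queues, each factor of the tail being at most rho_m. *)
Lemma stationary_max_ge (R : realType) (n m : nat) (N : network R n) (kappa : R)
    (nu : state n m -> R) (k : nat) :
  0 < kappa -> (0 < n)%N -> homogeneous N kappa ->
  stationary_distribution (transition_rate N) nu ->
  \sum_(l : state n m | [exists i, k <= qlen l i]%N) nu l <=
  n%:R * rho kappa n m ^+ k.
Proof.
move=> k0 n0 hN hnu; have [nu0 _ _] := hnu.
apply: (@le_trans _ _ (\sum_i \sum_(l : state n m | (k <= qlen l i)%N) nu l)).
  rewrite (exchange_big_dep (fun l : state n m => [exists i, k <= qlen l i]%N))/=.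
    apply: ler_sum => l /existsP[i hi].
    by rewrite (bigD1 i)//= lerDl sumr_ge0.
  by move=> i l _ hi; apply/existsP; exists i.
under eq_bigr => i _ do rewrite (stationary_tail1 _ _ k0 n0 hN hnu).
rewrite sumr_const card_ord -[leLHS]mulr_natl ler_wpM2l//.
rewrite -[k in leRHS]card_ord -prodr_const; apply: ler_prod => t _.
have /andP[-> _]/= := rho_itv (m - t) k0 n0.
by rewrite rho_homo// leq_subr.
Qed.

(** Chebyshev's inequality for the number X of queues of length at least k: its mean is n q, and P(X
    = 0) (n q)^2 <= Var X <= n q. Moreover q >= r^k, as all k factors of q are at least r. *)
Lemma stationary_max_lt (R : realType) (n m : nat) (N : network R n) (kappa : R)
    (nu : state n m -> R) (k : nat) (r : R) :
  0 < kappa -> (0 < n)%N -> homogeneous N kappa ->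
  stationary_distribution (transition_rate N) nu ->
  0 < r -> r <= rho kappa n (m - k) ->
  \sum_(l : state n m | [forall i, qlen l i < k]%N) nu l <= (n%:R * r ^+ k)^-1.
Proof.
move=> k0 n0 hN hnu r0 rk; have [nu0 nu1 _] := hnu.
set q := \prod_(t < k) rho kappa n (m - t).
have rq : r ^+ k <= q.
  rewrite -[k in leLHS]card_ord -prodr_const; apply: ler_prod => t _.
  rewrite (ltW r0)/= (le_trans rk)// rho_homo// leq_sub2l//; exact: ltnW.
have n0' : 0 < n%:R :> R by rewrite ltr0n.
have q0 : 0 < q by rewrite (lt_le_trans _ rq)// exprn_gt0.
apply: (@le_trans _ _ (n%:R * q)^-1); last first.
  by rewrite lef_pV2 ?posrE ?mulr_gt0 ?exprn_gt0// ler_pM2l.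
pose X (l : state n m) : R := \sum_i (k <= qlen l i)%N%:R.
have ind (B : pred (state n m)) : \sum_l nu l * (B l)%:R = \sum_(l | B l) nu l.
  by rewrite [RHS]big_mkcond; apply: eq_bigr => l _; rewrite mulr_natr mulrb.
have EX : \sum_l nu l * X l = n%:R * q.
  under eq_bigr => l _ do rewrite mulr_sumr.
  rewrite exchange_big/=.
  under eq_bigr => i _ do
    rewrite (ind (fun l => k <= qlen l i)%N) (stationary_tail1 _ _ k0 n0 hN hnu).
  by rewrite sumr_const card_ord mulr_natl.
have EX2 : \sum_l nu l * X l ^+ 2 <= n%:R * q + (n%:R * q) ^+ 2.
  have -> : \sum_l nu l * X l ^+ 2 =
      \sum_i \sum_j \sum_(l | (k <= qlen l i)%N && (k <= qlen l j)%N) nu l.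
    under eq_bigr => l _ do rewrite expr2 /X mulr_suml mulr_sumr.
    rewrite exchange_big/=; apply: eq_bigr => i _.
    under eq_bigr => l _ do rewrite mulr_sumr mulr_sumr.
    rewrite exchange_big/=; apply: eq_bigr => j _.
    rewrite -ind; apply: eq_bigr => l _.
    by rewrite -natrM mulnb.
  apply: (@le_trans _ _ (\sum_(i < n) (q + n%:R * q ^+ 2))); last first.
    by rewrite sumr_const card_ord -[leLHS]mulr_natl; lra.
  (* The diagonal term is q; each off-diagonal term is at most q^2 by [stationary_tail2]. *)
  apply: ler_sum => i _; rewrite (bigD1 i)//= lerD//.
    under eq_bigl => l do rewrite andbb.
    by rewrite (stationary_tail1 _ _ k0 n0 hN hnu).
  apply: (@le_trans _ _ (\sum_(j < n) q ^+ 2)); last first.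
    by rewrite sumr_const card_ord -[leLHS]mulr_natl.
  rewrite [leRHS](bigD1 i)//= ler_wpDl ?sqr_ge0//.
  apply: ler_sum => j ji; have ij : i != j by rewrite eq_sym.
  exact: (stationary_tail2 k k0 n0 hN ij hnu).
(* Negative correlation bounds the variance of the number X of queues of
   length at least k by its mean n q. *)
have V : \sum_l nu l * (X l - n%:R * q) ^+ 2 <= n%:R * q.
  under eq_bigr => l _.
    rewrite (_ : _ * _ = nu l * X l ^+ 2 + (- (2 * (n%:R * q))) * (nu l * X l) +
      (n%:R * q) ^+ 2 * nu l); last by ring.
    over.
  rewrite !big_split/= -!mulr_sumr EX nu1; lra.
(* Where all queues are shorter than k, X = 0 and the squared deviation is (n q)^2. *)
have : \sum_(l : state n m | [forall i, qlen l i < k]%N) nu l * (n%:R * q) ^+ 2 <= n%:R * q.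
  apply: le_trans V; rewrite [leRHS](bigID (fun l : state n m => [forall i, qlen l i < k]%N))/=.
  rewrite ler_wpDr ?sumr_ge0// => [l _|]; first by rewrite mulr_ge0 ?sqr_ge0.
  apply: ler_sum => l /forallP hl; rewrite /X big1 ?sub0r ?sqrrN// => i _.
  by rewrite leqNgt hl.
rewrite -mulr_suml expr2 mulrA ger_pMl ?mulr_gt0// => h.
by rewrite -[leRHS]mul1r ler_pdivlMr// mulr_gt0.
Qed.

(** * From sums over states to events of the probability space *)

Lemma measurable_max_queue (R : realType) (n : nat) (d : measure_display)
    (T : measurableType d) (P : probability T R) (L : 'I_n -> {RV P >-> nat})
    (A : set nat) :
  measurable (max_queue L @^-1` A).
Proof.
suff H (s : seq 'I_n) : measurable_fun setT (fun w => \max_(i <- s) L i w)%N.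
  by rewrite -[X in measurable X]setTI; apply: (H (index_enum _)).
elim: s => [|i s IH].
  rewrite (_ : (fun _ => _) = cst 0%N); first exact: measurable_cst.
  by apply/funext => w; rewrite big_nil.
rewrite (_ : (fun _ => _) = (fun w => maxn (L i w) (\max_(j <- s) L j w)%N)).
  exact: measurable_realfun.measurable_fun_maxn.
by apply/funext => w; rewrite big_cons.
Qed.

(** A may contain points where L lies outside the state space, so the bound goes through the
    complement: the disjoint events L = l with l outside B avoid A, and their total mass is 1 minus
    that of B. *)
Lemma probability_le_states (R : realType) (n m : nat) (d : measure_display)
    (T : measurableType d) (P : probability T R) (L : 'I_n -> {RV P >-> nat})
    (A : set T) (B : pred (state n m)) :
  let nu (l : state n m) := fine (P [set w | forall i, L i w = qlen l i]) in
  \sum_l nu l = 1 -> measurable A ->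
  (forall w l, A w -> (forall i, L i w = qlen l i) -> B l) ->
  (P A <= (\sum_(l | B l) nu l)%:E)%E.
Proof.
move=> nu nu1 mA hA.
pose E (l : state n m) := [set w | forall i, L i w = qlen l i].
have mE l : measurable (E l).
  rewrite (_ : E l = \bigcap_(i in setT) (L i @^-1` [set qlen l i])); last first.
    by apply/seteqP; split => [w h i _|w h i]; exact: h.
  apply: fin_bigcap_measurable => [|i _]; first exact: finite_finset.
  by rewrite -[X in measurable X]setTI; exact: measurable_funP.
have tE (D : set (state n m)) : trivIset D E.
  move=> l l' _ _ [w [hl hl']]; apply/val_inj/ffunP => i; apply: ord_inj.
  by rewrite -[LHS]hl -[RHS]hl'.
have PE l : P (E l) = (nu l)%:E by rewrite /nu fineK// fin_num_measure//; exact: mE.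
have PU : P (\bigcup_(l in [set` [pred l | ~~ B l]]) E l) = (\sum_(l | ~~ B l) nu l)%:E.
  rewrite measure_fin_bigcup; last first.
  - by move=> l _; exact: mE.
  - exact: tE.
  - exact: finite_finset.
  rewrite -(@bigfs _ _ _ _ (index_enum _)) ?index_enum_uniq//; last first.
    by move=> l _; rewrite mem_index_enum.
  by rewrite -sumEFin; apply: eq_bigr => l _; exact: PE.
have mU : measurable (\bigcup_(l in [set` [pred l | ~~ B l]]) E l).
  by apply: fin_bigcup_measurable => //; exact: finite_finset.
have : (P (\bigcup_(l in [set` [pred l | ~~ B l]]) E l) <= P (~` A))%E.
  rewrite le_measure ?inE//; first exact: measurableC.
  by move=> w [l /= /negP lB wl] Aw; apply: lB; exact: hA wl.
rewrite PU probability_setC// -(fineK (fin_num_measure P A mA)) -EFinB !lee_fin.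
have := nu1; rewrite (bigID B)/=; lra.
Qed.

(** * Asymptotics of the utilization *)

Lemma natr_near_ge (R : realType) (A : R) : \forall m \near \oo, A <= m%:R :> R.
Proof.
near=> m; apply: (@le_trans _ _ (Num.truncn A).+1%:R); first exact/ltW/truncnS_gt.
by rewrite ler_nat; near: m; exact: nbhs_infty_ge.
Unshelve. all: end_near. Qed.

Lemma cvg_ratio_near (R : realType) (u : nat -> R) (l e : R) : 0 < e ->
  u m / m%:R @[m --> \oo] --> l ->
  \forall m \near \oo, (l - e) * m%:R <= u m <= (l + e) * m%:R.
Proof.
move=> e0 ul; near=> m.
have m0 : 0 < m%:R :> R by rewrite (@lt_le_trans _ _ 1)//; near: m; exact: natr_near_ge.
rewrite -ler_pdivlMr// -[X in _ && X]ler_pdivrMr//.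
rewrite -ler_distlC; near: m; exact: cvgr_dist_le.
Unshelve. all: end_near. Qed.

(* The two roots of the limiting quadratic are eta > 1 and q = kbar / eta <= 1:
   in terms of them, kbar = eta q and nbar = (eta - 1)(1 - q). *)
Lemma rho_near_lt (R : realType) (n : nat -> nat) (kappa : nat -> R)
    (eta q r : R) :
  (forall m, 0 < kappa m) -> n m @[m --> \oo] --> \oo ->
  1 < eta -> 0 <= q <= 1 ->
  kappa m / m%:R @[m --> \oo] --> eta * q ->
  (n m)%:R / m%:R @[m --> \oo] --> (eta - 1) * (1 - q) ->
  eta^-1 < r < 1 ->
  \forall m \near \oo, rho (kappa m) (n m) m < r.
Proof.
move=> k0 noo eta1 /andP[q0 q1] kl nl /andP[etar r1].
have eta0 : 0 < eta by rewrite (lt_trans ltr01).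
have etar1 : 1 < eta * r by rewrite mulrC -ltr_pdivrMr// mul1r.
have r0 : 0 < r by rewrite (lt_trans _ etar)// invr_gt0.
(* Divided by m, the quadratic of [rho_lt] tends to (1 - eta r) (1 - q r) = -4 e. The errors from
   kappa / m, n / m and the lone summand r cost at most e each. *)
pose e := (eta * r - 1) * (1 - q * r) / 4.
have qr1 : q * r < 1 by rewrite (le_lt_trans _ r1)// ler_piMl// ltW.
have e0 : 0 < e by rewrite /e !mulr_gt0 ?invr_gt0 ?subr_gt0.
have eE : (eta * r - 1) * (1 - q * r) = 4 * e by rewrite /e; field.
clearbody e.
near=> m.
have m1 : 1 <= m%:R :> R by near: m; exact: natr_near_ge.
have me : e^-1 <= m%:R :> R by near: m; exact: natr_near_ge.
have {}me : 1 <= e * m%:R by rewrite mulrC -ler_pdivrMr// mul1r.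
have /andP[kl1 kl2] : (eta * q - e) * m%:R <= kappa m <= (eta * q + e) * m%:R.
  by near: m; exact: cvg_ratio_near.
have /andP[nl1 nl2] : ((eta - 1) * (1 - q) - e) * m%:R <= (n m)%:R <=
    ((eta - 1) * (1 - q) + e) * m%:R.
  by near: m; exact: (@cvg_ratio_near R (fun m => (n m)%:R)).
apply: rho_lt => //.
- by near: m; move/cvgnyPgt : noo; exact.
- by rewrite -(ltr_nat R) (lt_le_trans ltr01).
move: (n m)%:R (kappa m) m%:R m1 me kl1 kl2 nl1 nl2 => y x z z1 ez kl1 kl2 nl1 nl2.
have T1 : 0 <= (x - (eta * q - e) * z) * (r * (1 - r)).
  by rewrite mulr_ge0 ?subr_ge0// mulr_ge0 ?subr_ge0 ?(ltW r0)// ltW.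
have T2 : 0 <= (y - ((eta - 1) * (1 - q) - e) * z) * r.
  by rewrite mulr_ge0 ?subr_ge0 ?(ltW r0).
have ez0 : 0 < e * z by rewrite mulr_gt0// (lt_le_trans ltr01).
have T3 : 0 <= e * z * (1 - r * (1 - r)).
  rewrite mulr_ge0 ?(ltW ez0)//; have := sqr_ge0 r; lra.
have T4 : 0 <= e * z * (1 - r) by rewrite mulr_ge0 ?(ltW ez0)// subr_ge0 ltW.
have E4 : (eta * r - 1) * (1 - q * r) * z = 4 * e * z by rewrite eE.
lra.
Unshelve. all: end_near. Qed.

(** Applies [le_rho] up to J = m - k from a start only a constant S of steps earlier. As k = o(m),
    the quadratic at the start, divided by m, still tends to G = (1 - eta r) (1 - q r) > 0. *)
Lemma rho_near_ge (R : realType) (n k : nat -> nat) (kappa : nat -> R)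
    (eta q r : R) :
  (forall m, 0 < kappa m) -> n m @[m --> \oo] --> \oo ->
  1 < eta -> 0 <= q <= 1 ->
  kappa m / m%:R @[m --> \oo] --> eta * q ->
  (n m)%:R / m%:R @[m --> \oo] --> (eta - 1) * (1 - q) ->
  (k m)%:R / m%:R @[m --> \oo] --> (0 : R) ->
  0 < r < eta^-1 ->
  \forall m \near \oo, r <= rho (kappa m) (n m) (m - k m).
Proof.
move=> k0 noo eta1 /andP[q0 q1] kl nl kkl /andP[r0 etar].
have eta0 : 0 < eta by rewrite (lt_trans ltr01).
have etar1 : eta * r < 1 by rewrite mulrC -ltr_pdivlMr// mul1r.
have r1 : r < 1 by rewrite (lt_trans etar)// invf_lt1.
have qr1 : q * r < 1 by rewrite (le_lt_trans _ r1)// ler_piMl// ltW.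
pose G := (1 - eta * r) * (1 - q * r).
have G0 : 0 < G by rewrite mulr_gt0 ?subr_gt0.
pose D := eta + q - 2 * (eta * q) * r.
have D0 : 0 < D.
  have : q * (eta * r) <= q by rewrite ler_piMr// ltW.
  rewrite /D; lra.
have B0 : 0 < eta + q + 1 by lra.
(* Eventually kappa + n + J <= (eta + q + 1) m, so steps of size c use only half of G. *)
pose c := G / 2 / (eta + q + 1).
have c0 : 0 < c by rewrite /c !divr_gt0.
have cE : c * (eta + q + 1) = G / 2 by rewrite /c divfK// gt_eqF.
pose S := (Num.truncn c^-1).+1.
have cS : 1 < c * S%:R.
  by rewrite mulrC -ltr_pdivrMr// mul1r truncnS_gt.
(* Four errors of at most e each, from kappa, n, k and S, must fit into G / 2 and into D; e <= 1/4
   ensures k + S <= m. *)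
pose e := Num.min (G / 8) (Num.min (D / 4) (4^-1)).
have e0 : 0 < e by rewrite !lt_min (divr_gt0 G0) ?(divr_gt0 D0)//= invr_gt0 ltr0n.
have eG : e <= G / 8 by rewrite ge_min lexx.
have eD : e <= D / 4 by rewrite !ge_min lexx orbT.
have e4 : e <= 4^-1 by rewrite !ge_min lexx !orbT.
have GE : G = (1 - eta * r) * (1 - q * r) by [].
have DE : D = eta + q - 2 * (eta * q) * r by [].
clearbody e S c G D.
near=> m.
have m1 : 1 <= m%:R :> R by near: m; exact: natr_near_ge.
have me : S%:R / e <= m%:R :> R by near: m; exact: natr_near_ge.
have {}me : S%:R <= e * m%:R by rewrite mulrC -ler_pdivrMr.
have /andP[kl1 kl2] : (eta * q - e) * m%:R <= kappa m <= (eta * q + e) * m%:R.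
  by near: m; exact: cvg_ratio_near.
have /andP[nl1 nl2] : ((eta - 1) * (1 - q) - e) * m%:R <= (n m)%:R <=
    ((eta - 1) * (1 - q) + e) * m%:R.
  by near: m; exact: (@cvg_ratio_near R (fun m => (n m)%:R)).
have /andP[_ kkl2] : (0 - e) * m%:R <= (k m)%:R <= (0 + e) * m%:R.
  by near: m; exact: (@cvg_ratio_near R (fun m => (k m)%:R)).
have e4m : e * m%:R <= 4^-1 * m%:R by rewrite ler_wpM2r.
have kSm : (k m + S <= m)%N by rewrite -(ler_nat R) natrD; lra.
have j0E : (m - (k m + S))%:R = m%:R - (k m)%:R - S%:R :> R.
  by rewrite natrB// natrD; lra.
have JE : (m - k m)%:R = m%:R - (k m)%:R :> R.
  by rewrite natrB// (leq_trans (leq_addr _ _) kSm).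
apply: (@le_rho _ _ _ (m - (k m + S)) _ S c) => //.
- by near: m; move/cvgnyPgt : noo; exact.
- by rewrite !ltW.
- exact: ltW.
- by rewrite subnDA subnK// leq_subRL// (leq_trans (leq_addr _ _) kSm).
- rewrite j0E; have x0 := k0 m.
  move: (n m)%:R (kappa m) m%:R (k m)%:R S%:R m1 me kl1 kl2 nl1 nl2 kkl2 x0
    => y x z kk s z1 ez kl1 kl2 nl1 nl2 kk2 x0.
  have T1 : 0 <= (x - (eta * q - e) * z) * (1 - r).
    by rewrite mulr_ge0 ?subr_ge0 ?(ltW r1).
  have T2 : 0 <= ((eta * q + e) * z - x) * r.
    by rewrite mulr_ge0 ?subr_ge0 ?(ltW r0).
  have T3 : 0 <= (D / 4 - e) * z.
    by rewrite mulr_ge0 ?subr_ge0// (le_trans ler01).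
  rewrite DE in T3; lra.
- rewrite j0E JE; have x0 := k0 m; have kk0 : 0 <= (k m)%:R :> R by [].
  have s0 : 0 <= S%:R :> R by [].
  move: (n m)%:R (kappa m) m%:R (k m)%:R S%:R m1 me kl1 kl2 nl1 nl2 kkl2 x0 kk0 s0 e4m
    => y x z kk s z1 ez kl1 kl2 nl1 nl2 kk2 x0 kk0 s0 e4m.
  apply: (@le_trans _ _ (G / 2 * z)).
    rewrite -cE -mulrA ler_pM2l//; lra.
  have T1 : 0 <= ((eta * q + e) * z - x) * (r * (1 - r)).
    by rewrite mulr_ge0 ?subr_ge0// mulr_ge0 ?subr_ge0 ?(ltW r0)// ltW.
  have T2 : 0 <= (((eta - 1) * (1 - q) + e) * z - y) * r.
    by rewrite mulr_ge0 ?subr_ge0 ?(ltW r0).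
  have T3 : 0 <= (e * z - kk) * (1 - r) by rewrite mulr_ge0 ?subr_ge0 ?(ltW r1)//; lra.
  have T4 : 0 <= (e * z - s) * (1 - r) by rewrite mulr_ge0 ?subr_ge0 ?(ltW r1).
  have T5 : 0 <= (G / 8 - e) * z.
    by rewrite mulr_ge0 ?subr_ge0// (le_trans ler01).
  have ez0 : 0 <= e * z by lra.
  have T6 : 0 <= e * z * r by rewrite mulr_ge0 ?(ltW r0).
  have T7 : 0 <= e * z * (1 - r) by rewrite mulr_ge0 ?subr_ge0 ?(ltW r1).
  have T8 : 0 <= e * z * r * r by rewrite mulr_ge0 ?(ltW r0).
  have E4 : G * z = (1 - eta * r) * (1 - q * r) * z by rewrite GE.
  lra.
Unshelve. all: end_near. Qed.

Lemma cvg_ln_natr (R : realType) (n : nat -> nat) :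
  n m @[m --> \oo] --> \oo -> ln (n m)%:R @[m --> \oo] --> (+oo : set_system R).
Proof.
move=> noo; apply/cvgryPge => A; near=> m.
rewrite -[leLHS]expRK ler_ln ?posrE ?expR_gt0//; last first.
  by rewrite ltr0n; near: m; move/cvgnyPgt : noo; exact.
apply: (@le_trans _ _ (Num.truncn (expR A)).+1%:R); first exact/ltW/truncnS_gt.
by rewrite ler_nat; near: m; move/cvgnyPge : noo; exact.
Unshelve. all: end_near. Qed.

(** From y^2 / 2 <= exp y at y = ln n follows ln n / m <= (2 / ln n) (n / m), a null sequence times
    a convergent one. The successor adds 1 / m. *)
Lemma cvg_truncn_ln_ratio (R : realType) (n : nat -> nat) (nbar C : R) :
  n m @[m --> \oo] --> \oo -> 0 <= C ->
  (n m)%:R / m%:R @[m --> \oo] --> nbar ->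
  (Num.truncn (C * ln (n m)%:R)).+1%:R / m%:R @[m --> \oo] --> (0 : R).
Proof.
move=> noo C0 nl; have lnoo := @cvg_ln_natr R n noo.
have lpos : \forall m \near \oo, 0 < ln (n m)%:R :> R.
  by move/cvgryPgt : lnoo; exact.
have l0 : (ln (n m)%:R : R)^-1 @[m --> \oo] --> (0 : R) by apply/gtr0_cvgV0.
have h0 : (m%:R : R)^-1 @[m --> \oo] --> (0 : R).
  apply/gtr0_cvgV0; first by near=> m; rewrite ltr0n; near: m; exact: nbhs_infty_gt.
  by apply/cvgryPge => A; exact: natr_near_ge.
apply: (@squeeze_cvgr _ _ _ _ (cst 0) (fun m =>
    C * (2 * (ln (n m)%:R)^-1 * ((n m)%:R / m%:R)) + (m%:R)^-1)); last 2 first.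
- exact: cvg_cst.
- suff : C * (2 * (ln (n m)%:R)^-1 * ((n m)%:R / m%:R)) + (m%:R)^-1
      @[m --> \oo] --> C * (2 * 0 * nbar) + (0 : R).
    by rewrite mulr0 mul0r mulr0 addr0.
  apply: cvgD h0; apply: cvgM; first exact: cvg_cst.
  by apply: cvgM nl; apply: cvgM l0; exact: cvg_cst.
near=> m; rewrite divr_ge0//=.
have n1 : 0 < (n m)%:R :> R by rewrite ltr0n; near: m; move/cvgnyPgt : noo; exact.
have m1 : 0 < m%:R :> R by rewrite ltr0n; near: m; exact: nbhs_infty_gt.
have y0 : 0 < ln (n m)%:R :> R by near: m; exact: lpos.
rewrite ler_pdivrMr// mulrDl mulVf ?gt_eqF//.
rewrite -natr1 lerD2r; apply: (@le_trans _ _ (C * ln (n m)%:R)).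
  by rewrite truncn_le mulr_ge0 ?(ltW y0).
rewrite -[leRHS]mulrA ler_wpM2l//.
rewrite -!mulrA mulVf ?gt_eqF// mulr1 mulrCA mulrC ler_pdivlMr//.
have := @expR_ge1Dxn R (ln (n m)%:R) 1 (ltW y0); rewrite lnK ?posrE// expr2.
rewrite (_ : 2`! = 2)%N//; lra.
Unshelve. all: end_near. Qed.

(** * Convergence in probability of the scaled maximum *)

Lemma max_queue_bound (R : realType) (n m : nat) (N : network R n) (kappa : R)
    (d : measure_display) (T : measurableType d) (P : probability T R)
    (L : 'I_n -> {RV P >-> nat}) (A : set T) (K k : nat) (r : R) :
  0 < kappa -> (0 < n)%N -> homogeneous N kappa -> stationary_vector m N L ->
  measurable A -> 0 < r -> r <= rho kappa n (m - k) ->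
  (forall w, A w -> (K <= max_queue L w)%N || (max_queue L w < k)%N) ->
  (P A <= (n%:R * rho kappa n m ^+ K + (n%:R * r ^+ k)^-1)%:E)%E.
Proof.
move=> k0 n0 hN hL mA r0 rk hA; have [nu0 nu1 _] := hL.
pose B1 := [pred l : state n m | [exists i, K <= qlen l i]%N].
pose B2 := [pred l : state n m | [forall i, qlen l i < k]%N].
apply: le_trans (probability_le_states (B := predU B1 B2) nu1 mA _) _.
  move=> w l Aw wl /=; have := hA w Aw.
  have -> : max_queue L w = (\max_i qlen l i)%N by apply: eq_bigr => i _; rewrite wl.
  move=> /orP[KM|Mk]; apply/orP; [left|right].
    have [|i0 iM] := @bigop.eq_bigmax _ (qlen l); first by rewrite card_ord.
    by apply/existsP; exists i0; rewrite -iM.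
  by apply/forallP => i; apply: leq_ltn_trans Mk; exact: bigop.leq_bigmax.
rewrite lee_fin.
have := stationary_max_ge K k0 n0 hN hL; have := stationary_max_lt k0 n0 hN hL r0 rk.
move=> h2 h1; apply: le_trans (lerD h1 h2).
rewrite [leLHS]big_mkcond [X in _ <= X + _]big_mkcond [X in _ <= _ + X]big_mkcond.
rewrite -big_split/=; apply: ler_sum => l _.
have := nu0 l.
case: [exists i, _]; case: [forall i, _] => /=; lra.
Qed.

(** The thresholds are (1 + e) ln n / ln eta and (1 - e) ln n / ln eta. With r1 slightly above 1 /
    eta and r2 slightly below, both terms of [max_queue_bound] are of order n^(-e/2). *)
Lemma max_queue_cvg (R : realType)
    (n : nat -> nat) (kappa : nat -> R)
    (N : forall m : nat, network R (n m))
    (d : nat -> measure_display) (T : forall m : nat, measurableType (d m))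
    (P : forall m : nat, probability (T m) R)
    (L : forall m : nat, 'I_(n m) -> {RV (P m) >-> nat}) (eta q : R) :
  (forall m, 0 < kappa m) -> (forall m, homogeneous (N m) (kappa m)) ->
  (forall m, stationary_vector m (N m) (L m)) ->
  n m @[m --> \oo] --> \oo ->
  1 < eta -> 0 <= q <= 1 ->
  kappa m / m%:R @[m --> \oo] --> eta * q ->
  (n m)%:R / m%:R @[m --> \oo] --> (eta - 1) * (1 - q) ->
  cvg_in_probability P
    (fun m w => ln eta / ln (n m)%:R * (max_queue (L m) w)%:R) 1.
Proof.
move=> k0 hN hL noo eta1 q01 kl nl eps eps0.
have eta0 : 0 < eta by rewrite (lt_trans ltr01).
pose a := ln eta; have a0 : 0 < a by rewrite ln_gt0.
have aE : expR a = eta by rewrite lnK// posrE.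
pose e := Num.min eps 2^-1.
have e0 : 0 < e by rewrite lt_min eps0/= invr_gt0.
have e1 : e < 1 by rewrite gt_min invf_lt1 ?ltr1n ?orbT.
have eeps : e <= eps by rewrite ge_min lexx.
have lnoo := @cvg_ln_natr R n noo.
(* With r1 = eta^(-s1) and r2 = eta^(-s2), these exponents make r1^(c1 ln n) = n^(-(1 + e/2)) and
   r2^(c2 ln n) = n^(-(1 - e/2)). *)
pose s1 := (1 + e / 2) / (1 + e); pose s2 := (1 - e / 2) / (1 - e).
have s1E : s1 * (1 + e) = 1 + e / 2 by rewrite /s1 divfK// gt_eqF//; lra.
have s2E : s2 * (1 - e) = 1 - e / 2 by rewrite /s2 divfK// gt_eqF//; lra.
have s10 : 0 < s1 by rewrite divr_gt0//; lra.
have s11 : s1 < 1 by rewrite ltr_pdivrMr; lra.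
have s21 : 1 < s2 by rewrite ltr_pdivlMr; lra.
clearbody e s1 s2.
pose r1 := expR (- (a * s1)); pose r2 := expR (- (a * s2)).
have r1P : eta^-1 < r1 < 1.
  rewrite -aE -expRN ltr_expR ltrN2 gtr_pMr// s11/=.
  by rewrite /r1 -[ltRHS]expR0 ltr_expR oppr_lt0 mulr_gt0.
have r2P : 0 < r2 < eta^-1.
  by rewrite expR_gt0/= -aE -expRN ltr_expR ltrN2 ltr_pMr.
pose c1 := (1 + e) / a; pose c2 := (1 - e) / a.
have c10 : 0 <= c1 by rewrite divr_ge0 ?(ltW a0)//; lra.
have c20 : 0 <= c2 by rewrite divr_ge0 ?(ltW a0)//; lra.
pose y m : R := ln (n m)%:R.
(* With the successors, M >= K means M > c1 y and M < k means M <= c2 y. Rounding k up costs the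
   factor [r2^-1] in [h]. *)
pose K m := (Num.truncn (c1 * y m)).+1; pose k m := (Num.truncn (c2 * y m)).+1.
have kl0 : (k m)%:R / m%:R @[m --> \oo] --> (0 : R) by exact: cvg_truncn_ln_ratio nl.
have up := rho_near_lt k0 noo eta1 q01 kl nl r1P.
have lo := rho_near_ge k0 noo eta1 q01 kl nl kl0 r2P.
pose h m : R := (1 + r2^-1) * expR (- (e / 2 * y m)).
have h0 : h m @[m --> \oo] --> (0 : R).
  rewrite -(mulr0 (1 + r2^-1)); apply: cvgM; first exact: cvg_cst.
  refine (@cvg_comp _ _ _ (fun m => e / 2 * y m) (fun x => expR (- x)) _ _ _ _ (@cvgr_expR R)).
  apply/cvgryPge => A; near=> m; rewrite mulrC -ler_pdivrMr ?divr_gt0//.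
  by near: m; move/cvgryPge : lnoo; exact.
apply: (@squeeze_cvge _ _ _ _ (cst 0%E) _ (EFin \o h)); last 2 first.
- exact: cvg_cst.
- by apply: cvg_EFin h0; near=> m.
near=> m.
rewrite measure_ge0/=.
have n0 : (0 < n m)%N by near: m; move/cvgnyPgt : noo; exact.
have n0' : 0 < (n m)%:R :> R by rewrite ltr0n.
have y0 : 0 < y m by near: m; move/cvgryPgt : lnoo; exact.
have hup : rho (kappa m) (n m) m < r1 by near: m; exact: up.
have hlo : r2 <= rho (kappa m) (n m) (m - k m) by near: m; exact: lo.
apply: le_trans (max_queue_bound (K := K m) (k := k m) (k0 m) n0 (hN m) (hL m) _ _ hlo _) _.
- exact: (measurable_max_queue (L m) [set p | eps < `|ln eta / ln (n m)%:R * p%:R - 1|]).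
- exact: expR_gt0.
- move=> w /= hw; rewrite orbC; case: ltnP => //= kM.
  move: hw; set M := max_queue (L m) w in kM *.
  rewrite -/a -/(y m) => hw.
  rewrite /K truncn_lt_nat ?(mulr_ge0 c10 (ltW y0))// /c1 mulrAC ltr_pdivrMr//.
  have : c2 * y m < M%:R by rewrite -truncn_lt_nat// (mulr_ge0 c20 (ltW y0)).
  rewrite /c2 mulrAC ltr_pdivrMr// => hM.
  have z1 : 1 - e < a / y m * M%:R by rewrite mulrAC ltr_pdivlMr// [a * _]mulrC.
  have : e < `|a / y m * M%:R - 1| by apply: le_lt_trans hw.
  rewrite lter_normr => /orP[|]; last by lra.
  rewrite ltrBrDl [1 + e]/(1 + e) mulrAC ltr_pdivlMr// [a * _]mulrC; done.
rewrite lee_fin /h mulrDl mul1r.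
have nE : (n m)%:R = expR (y m) by rewrite lnK// posrE.
have rho0 : 0 <= rho (kappa m) (n m) m by have /andP[] := rho_itv m (k0 m) n0.
apply: lerD.
  apply: (@le_trans _ _ ((n m)%:R * r1 ^+ K m)).
    by rewrite ler_wpM2l// lerXn2r ?nnegrE ?expR_ge0// ltW.
  rewrite nE -expRM_natr -expRD ler_expR.
  have : a * s1 * (c1 * y m) <= a * s1 * (K m)%:R.
    by rewrite ler_wpM2l ?mulr_ge0 ?(ltW a0) ?(ltW s10)//; exact/ltW/truncnS_gt.
  have -> : a * s1 * (c1 * y m) = (1 + e / 2) * y m.
    by rewrite -s1E /c1; field; rewrite gt_eqF.
  lra.
rewrite -[r2^-1]expRN opprK -expRM_natr nE -expRD -expRN -expRD ler_expR.
have : a * s2 * (k m)%:R <= a * s2 * (c2 * y m + 1).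
  rewrite ler_wpM2l ?mulr_ge0 ?(ltW a0)//; first lra.
  by rewrite -natr1 lerD2r truncn_le (mulr_ge0 c20 (ltW y0)).
have -> : a * s2 * (c2 * y m + 1) = (1 - e / 2) * y m + a * s2.
  by rewrite -s2E /c2; field; rewrite gt_eqF.
lra.
Unshelve. all: end_near. Qed.

(** * The root eta of the limiting quadratic and the two regimes *)

(** The discriminant exceeds (B - 2)^2 by 4 nbar, which puts the larger root above 1. *)
Lemma limit_root_exists (R : realType) (nbar kbar : R) : 0 < nbar -> 0 <= kbar ->
  exists2 eta, 1 < eta & eta ^+ 2 - eta * (nbar + kbar + 1) + kbar = 0.
Proof.
move=> n0 k0; set B := nbar + kbar + 1.
pose s := Num.sqrt (B ^+ 2 - 4 * kbar).
have D0 : (B - 2) ^+ 2 < B ^+ 2 - 4 * kbar by rewrite /B; lra.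
have s2 : s ^+ 2 = B ^+ 2 - 4 * kbar.
  by rewrite sqr_sqrtr// ltW// (le_lt_trans _ D0)// sqr_ge0.
have s0 : 0 <= s by exact: sqrtr_ge0.
exists ((B + s) / 2); last by apply/eqP; rewrite -subr_eq0; nra.
suff : `|B - 2| < s by rewrite ltr_norml; lra.
by rewrite -(ltr_pXn2r (ltn0Sn 1)) ?nnegrE// real_normK ?num_real// s2.
Qed.

(** Two distinct roots have sum nbar + kbar + 1 and product kbar, so (z - 1) (eta - 1) = -nbar <
    0. *)
Lemma limit_root_unique (R : realType) (nbar kbar eta z : R) : 0 < nbar ->
  1 < eta -> eta ^+ 2 - eta * (nbar + kbar + 1) + kbar = 0 ->
  1 < z -> z ^+ 2 - z * (nbar + kbar + 1) + kbar = 0 -> z = eta.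
Proof.
move=> n0 eta1 he z1 hz; apply/eqP; rewrite -subr_eq0; apply/negPn/negP => ze.
have : (z - eta) * (z + eta - (nbar + kbar + 1)) = 0 by lra.
move/eqP; rewrite mulf_eq0 (negbTE ze)/= => /eqP hs.
have : 0 < (z - 1) * (eta - 1) by rewrite mulr_gt0 ?subr_gt0.
have : eta * (z + eta - (nbar + kbar + 1)) = 0 by rewrite hs mulr0.
lra.
Qed.

Unset Implicit Arguments.

Theorem theorem1 (R : realType)
    (n : nat -> nat) (kappa : nat -> R) (kbar : R)
    (N : forall m : nat, network R (n m))
    (d : nat -> measure_display) (T : forall m : nat, measurableType (d m))
    (P : forall m : nat, probability (T m) R)
    (L : forall m : nat, 'I_(n m) -> {RV (P m) >-> nat})
    (kappa_gt0 : forall m : nat, 0 < kappa m)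
    (kbar_ge0 : 0 <= kbar)
    (kappa_lim : kappa m / m%:R @[m --> \oo] --> kbar)
    (N_homogeneous : forall m : nat, homogeneous (N m) (kappa m))
    (L_stationary : forall m : nat, stationary_vector m (N m) (L m))
    (n_infty : n m @[m --> \oo] --> \oo) :
  (1 < kbar -> (n m)%:R / m%:R @[m --> \oo] --> (0 : R) ->
    cvg_in_probability P
      (fun m w => ln kbar / ln (n m)%:R * (max_queue (L m) w)%:R) 1)
  /\
  (forall nbar : R, 0 < nbar -> (n m)%:R / m%:R @[m --> \oo] --> nbar ->
    exists eta : R,
      [/\ 1 < eta,
          eta ^+ 2 - eta * (nbar + kbar + 1) + kbar = 0,
          forall z : R, 1 < z ->
            z ^+ 2 - z * (nbar + kbar + 1) + kbar = 0 -> z = eta &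
          cvg_in_probability P
            (fun m w => ln eta / ln (n m)%:R * (max_queue (L m) w)%:R) 1]).
Proof.
split=> [kbar1 nl|nbar nbar0 nl].
  (* Here nbar = 0 and eta = kbar, so the other parameter is q = 1. *)
  apply: (max_queue_cvg kappa_gt0 N_homogeneous L_stationary n_infty kbar1 (q := 1)).
  - by rewrite ler01 lexx.
  - by rewrite mulr1.
  - by rewrite subrr mulr0.
have [eta eta1 he] := limit_root_exists nbar0 kbar_ge0.
exists eta; split=> //; first by move=> z; exact: limit_root_unique.
have eta0 : 0 < eta by rewrite (lt_trans ltr01).
(* Now q = kbar / eta: [nE] is the equation of eta divided by eta, and nbar > 0 with eta > 1 then
   forces q <= 1. *)
have qE : eta * (kbar / eta) = kbar by rewrite mulrCA divff ?mulr1// gt_eqF.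
have nE : (eta - 1) * (1 - kbar / eta) = nbar.
  apply: (mulfI (lt0r_neq0 eta0)); rewrite mulrCA mulrBr mulr1 qE; lra.
apply: (max_queue_cvg kappa_gt0 N_homogeneous L_stationary n_infty eta1 (q := kbar / eta)).
- rewrite divr_ge0 ?(ltW eta0)//= -subr_ge0.
  by rewrite -(pmulr_rge0 _ (_ : 0 < eta - 1)) ?subr_gt0// nE ltW.
- by rewrite qE.
- by rewrite nE.
Qed.
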